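(* Let $c:E^1\to G$ be a labelling of a row-finite directed graph $E$ by a discrete group $G$ such that for each infinite path $\mu=\mu_1\mu_2\cdots\in E^\infty$ there exists $i\in\mathbb{N}$ (with $i\ge 1$) such that $c(\mu_1\ldots\mu_i)=1_G$. Then the skew product graph $E\times_c G$ has a row-finite and path-finite directed subtree with set of roots $E^0\times\{1_G\}$ and vertex set $H_{E\times_c G}(E^0\times\{1_G\})$.
   Context: A directed graph $E=(E^0,E^1,s,r)$ consists of a vertex set $E^0$, an edge set $E^1$, and source and range maps $s,r:E^1\to E^0$. Finite paths are $\mu=\mu_1\cdots\mu_n$ with $r(\mu_i)=s(\mu_{i+1})$; vertices are paths of length $0$. For a graph $F$, $F^*$ is its set of finite paths. A path (finite, or infinite in the right-, left- or bi-infinite sense) is vertex-simple if its sequence of vertices contains no repetition; paths of length $0$ are vertex-simple. A graph is row-finite if each vertex emits finitely many edges, acyclic if all its finite and infinite paths are vertex-simple, and path-finite if it has no vertex-simple infinite path. In the hypothesis on $c$, $E^\infty$ refers to the right-infinite paths $\mu_1\mu_2\cdots$ with $r(\mu_i)=s(\mu_{i+1})$ for all $i\ge 1$. A labelling of $E$ by $G$ is a function $c:E^1\to G$; for a path $\mu=\mu_1\cdots\mu_n$, $c(\mu)=c(\mu_1)c(\mu_2)\cdots c(\mu_n)$. $1_G$ is the identity of $G$. The skew product $E\times_cG$ is the directed graph with vertex set $E^0\times G$, edge set $E^1\times G$, and $s(e,s)=(s(e),c(e)s)$, $r(e,s)=(r(e),s)$. For a directed graph $F$ and $u,v\in F^0$,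 $u\ge_Fv$ means there is a finite path in $F$ from $u$ to $v$. A set $Y\subseteq F^0$ is hereditary if $v\in Y$ and $v\ge_Fu$ imply $u\in Y$; $H_F(X)$ is the smallest hereditary subset of $F^0$ containing $X$. A directed subtree of $F$ is an acyclic subgraph $T$ such that every $v\in T^0$ satisfies $|T^1\cap r^{-1}(v)|\le1$. Its set of roots is $T^r=\{v\in T^0:|T^1\cap r^{-1}(v)|=0\}$. *)

(* Defs.v *)
From Stdlib Require List.
From mathcomp Require Import all_boot ssralg ssrint.
From mathcomp Require Import boolp classical_sets functions cardinality.

Set Implicit Arguments.
Unset Strict Implicit.
Unset Printing Implicit Defensive.

Local Open Scope classical_set_scope.

Record digraph := Digraph {
  vertex : Type;
  edge : Type;
  esrc : edge -> vertex;
  erng : edge -> vertex }.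

Section Paths.
Variable F : digraph.
Implicit Types (u v : vertex F) (p : seq (edge F)).

(* A finite path is a starting vertex together with a list of consecutive
   edges; the paths of length 0 are those with an empty list. *)
Fixpoint finite_path u p : Prop :=
  if p is e :: q then esrc e = u /\ finite_path (erng e) q else True.

Definition path_vertices u p : seq (vertex F) := u :: map (@erng F) p.

Definition path_range u p : vertex F := last u (map (@erng F) p).

(* mu 0, mu 1, ... are the successive edges. *)
Definition right_infinite_path (mu : nat -> edge F) : Prop :=
  forall i, erng (mu i) = esrc (mu i.+1).

(* mu 0 is the last edge, mu 1 the edge before it, and so on. *)
Definition left_infinite_path (mu : nat -> edge F) : Prop :=
  forall i, erng (mu i.+1) = esrc (mu i).

Definition bi_infinite_path (mu : int -> edge F) : Prop :=
  forall i, erng (mu i) = esrc (mu (i + 1)%R).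

Definition vertex_simple u p : Prop := List.NoDup (path_vertices u p).

(* The vertices of an infinite path are listed without omission by the sources
   of its edges, except in the left-infinite case, where the ranges are needed
   to include the final vertex. *)
Definition right_vertex_simple (mu : nat -> edge F) : Prop :=
  injective (fun i => esrc (mu i)).

Definition left_vertex_simple (mu : nat -> edge F) : Prop :=
  injective (fun i => erng (mu i)).

Definition bi_vertex_simple (mu : int -> edge F) : Prop :=
  injective (fun i => esrc (mu i)).

Definition row_finite : Prop := forall v, finite_set [set e | @esrc F e = v].

Definition acyclic : Prop :=
  [/\ forall u p, finite_path u p -> vertex_simple u p,
      forall mu, right_infinite_path mu -> right_vertex_simple mu,
      forall mu, left_infinite_path mu -> left_vertex_simple mu
    & forall mu, bi_infinite_path mu -> bi_vertex_simple mu].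

Definition path_finite : Prop :=
  [/\ ~ exists mu, right_infinite_path mu /\ right_vertex_simple mu,
      ~ exists mu, left_infinite_path mu /\ left_vertex_simple mu
    & ~ exists mu, bi_infinite_path mu /\ bi_vertex_simple mu].

Definition reaches u v : Prop := exists2 p, finite_path u p & path_range u p = v.

Definition hereditary (Y : set (vertex F)) : Prop :=
  forall v u, Y v -> reaches v u -> Y u.

Definition hereditary_closure (X : set (vertex F)) : set (vertex F) :=
  smallest hereditary X.

End Paths.

Record subgraph (F : digraph) := Subgraph {
  svertex : set (vertex F);
  sedge : set (edge F);
  sedge_src : forall e, sedge e -> svertex (esrc e);
  sedge_rng : forall e, sedge e -> svertex (erng e) }.

Definition digraph_of_subgraph (F : digraph) (T : subgraph F) : digraph :=
  @Digraph (svertex T) (sedge T)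
    (fun e => SigSub (mem_set (sedge_src (set_valP e))))
    (fun e => SigSub (mem_set (sedge_rng (set_valP e)))).
Coercion digraph_of_subgraph : subgraph >-> digraph.

Definition sedge_into (F : digraph) (T : subgraph F) (v : vertex F) :
    set (edge F) :=
  sedge T `&` (@erng F) @^-1` [set v].

Definition directed_subtree (F : digraph) (T : subgraph F) : Prop :=
  acyclic T /\ forall v, svertex T v -> is_subset1 (sedge_into T v).

Definition subtree_roots (F : digraph) (T : subgraph F) : set (vertex F) :=
  [set v | svertex T v /\ sedge_into T v = set0].

Section SkewProduct.
Variables (E : digraph) (G : groupType) (c : edge E -> G).

Definition label_path (p : seq (edge E)) : G := (\big[*%g/1]_(e <- p) c e)%g.

Definition skew_product : digraph :=
  @Digraph (vertex E * G) (edge E * G)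
    (fun eg => (esrc eg.1, (c eg.1 * eg.2)%g))
    (fun eg => (erng eg.1, eg.2)).

End SkewProduct.

(* Main.v *)
Require Import Defs.
From mathcomp Require Import all_boot ssralg ssrint.
From mathcomp Require Import boolp classical_sets functions cardinality.
Local Open Scope classical_set_scope.

(** The subtree is a breadth-first spanning forest. In any digraph, and for any
    set [X] of vertices, let the depth of a vertex of [hereditary_closure X] be
    the length of a shortest path to it from [X], and keep, for each vertex of
    positive depth, exactly one of the edges that arrive from a vertex of
    smaller depth ([breadth_first_subtree]). The vertices without incoming edge
    are then those of depth zero, that is, the elements of [X].

    Depth strictly increases along the edges of the forest. Hence no vertex is
    ever revisited, and no path extends infinitely far backwards, since depths
    are natural numbers ([ranked_acyclic], [ranked_no_left_infinite]).

    The hypothesis on the labelling excludes right-infinite paths. Such a path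
    can be prolonged backwards, through the chosen edges, until it starts at a
    root ([right_infinite_path_from_root]), here at some [(v, 1)]. In the skew
    product, following a path [mu] turns the group coordinate [g] into
    [c(mu)^-1 g] ([skew_product_label]); as some nonempty initial segment of
    the projection to [E] has label [1], the path comes back to
    [E^0 x {1}] after at least one edge. It thus enters a root, which is
    absurd. *)

Set Implicit Arguments.
Unset Strict Implicit.
Unset Printing Implicit Defensive.

(** * Digraphs with a rank function *)

Section Ranked.
Variables (F : digraph) (f : vertex F -> nat).
Hypothesis f_lt : forall e, (f (esrc e) < f (erng e))%N.

Lemma ranked_path_lt u p w :
  finite_path u p -> List.In w (map (@erng F) p) -> (f u < f w)%N.
Proof.
elim: p u => [|e p IHp] u //= [<- ep] [<- //|/(IHp _ ep)].
exact: ltn_trans.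
Qed.

Lemma ranked_no_left_infinite mu : ~ left_infinite_path (F := F) mu.
Proof.
move=> muP.
have bound k : (f (erng (mu k)) + k <= f (erng (mu 0)))%N.
  elim: k => [|k IHk]; first by rewrite addn0.
  apply: leq_trans IHk; rewrite addnS -addSn leq_add2r.
  by rewrite (muP k).
have := bound (f (erng (mu 0))).+1.
by rewrite addnS ltnNge leq_addl.
Qed.

Lemma ranked_no_bi_infinite mu : ~ bi_infinite_path (F := F) mu.
Proof.
move=> muP.
apply: (@ranked_no_left_infinite (fun n => mu (- n%:Z)%R)) => n.
by rewrite muP -addn1 PoszD GRing.Theory.opprD GRing.Theory.subrK.
Qed.

Lemma ranked_acyclic : acyclic F.
Proof.
split.
- move=> u p; rewrite /vertex_simple /path_vertices.
  elim: p u => [|e p IHp] u up; first by constructor => //; constructor.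
  constructor; last by case: up => _ /IHp.
  by move=> /(ranked_path_lt up); rewrite ltnn.
- move=> mu muP.
  have incr : {homo (fun i => f (esrc (mu i))) : i j / (i < j)%N}.
    by apply: homo_ltn => [y x z|i]; [exact: ltn_trans | rewrite -muP].
  move=> i j eq_ij; apply: (incn_inj (leq_mono incr)).
  by rewrite eq_ij.
- by move=> mu /ranked_no_left_infinite.
- by move=> mu /ranked_no_bi_infinite.
Qed.

(** Going back along incoming edges lowers the rank, so it stops, and it can
    only stop in [R]. *)
Lemma right_infinite_path_from_root (R : set (vertex F)) (mu : nat -> edge F) :
  (forall v, R v \/ exists e, erng e = v) -> right_infinite_path mu ->
  exists nu : nat -> edge F, right_infinite_path nu /\ R (esrc (nu 0)).
Proof.
move=> RP; have [n] := ubnP (f (esrc (mu 0))).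
elim: n mu => // n IHn mu lt_n muP.
have [Rmu|[e e_mu]] := RP (esrc (mu 0)); first by exists mu.
apply: (IHn (fun i => if i is j.+1 then mu j else e)); last by case.
by apply: leq_trans (f_lt e) _; rewrite e_mu.
Qed.

End Ranked.

(** * Breadth-first spanning forests *)

Section BreadthFirst.
Variables (F : digraph) (X : set (vertex F)).

Fixpoint walk_ends n : set (vertex F) :=
  if n is m.+1 then [set erng e | e in [set e | walk_ends m (esrc e)]] else X.

Lemma hereditary_closureE : hereditary_closure X = \bigcup_n walk_ends n.
Proof.
apply/seteqP; split.
- apply: smallest_sub; last by move=> v Xv; exists 0.
  move=> v u + [p]; elim: p v => [|e p IHp] v Xv; first by move=> _ <-.
  move=> [e_v ep] /= pu; apply: (IHp (erng e)) => //.
  by case: Xv => n _ nv; exists n.+1 => //; exists e; rewrite //= e_v.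
- move=> v [n _]; elim: n v => [|n IHn] v; first exact: sub_gen_smallest.
  move=> [e /IHn esrcP <-] Y [YH XY].
  by apply: (YH (esrc e)); [exact: esrcP | exists [:: e]].
Qed.

Lemma walk_depth : exists d : vertex F -> nat, forall v,
  hereditary_closure X v ->
  walk_ends (d v) v /\ forall n, walk_ends n v -> (d v <= n)%N.
Proof.
suff /choice[d dP] : forall v, exists m, hereditary_closure X v ->
  walk_ends m v /\ forall n, walk_ends n v -> (m <= n)%N by exists d.
move=> v.
have [[n _ nv]|noH] := pselect ((\bigcup_n walk_ends n) v); last first.
  by exists 0; rewrite hereditary_closureE.
have exw : exists n, `[< walk_ends n v >] by exists n; apply/asboolP.
case: (ex_minnP exw) => m /asboolP mv m_min; exists m => _; split=> // k kv.
by apply: m_min; apply/asboolP.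
Qed.

Lemma breadth_first_subtree :
  exists (T : subgraph F) (d : vertex T -> nat),
    [/\ forall e : edge T, (d (esrc e) < d (erng e))%N,
        forall v, svertex T v -> is_subset1 (sedge_into T v),
        subtree_roots T = X
      & svertex T = hereditary_closure X].
Proof.
have [d dP] := walk_depth.
pose H := hereditary_closure X.
have XH : X `<=` H by exact: sub_gen_smallest.
(* The chosen edge into v is encoded as a set with at most one element, so that
   no default edge is required for the vertices that receive none. *)
have /choice[S SP] : forall v, exists Sv : set (edge F),
    [/\ is_subset1 Sv,
        forall e, Sv e ->
          [/\ erng e = v, H (esrc e), ~ X v & (d (esrc e) < d v)%N]
      & H v -> ~ X v -> Sv !=set0].
  move=> v.
  have [[Hv nXv]|nroot] := pselect (H v /\ ~ X v); last first.
    by exists set0; split=> // Hv nXv; case: nroot.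
  have [] := dP v Hv; case dv: (d v) => [|n] //= [e en ev] _.
  have He : H (esrc e) by rewrite /H hereditary_closureE; exists n.
  exists [set e]; split; [by move=> x y -> -> | | by exists e].
  move=> _ ->; split=> //.
  by rewrite ltnS; apply: (dP _ He).2.
pose T_edge : set (edge F) := [set e | S (erng e) e].
have T_src e : T_edge e -> H (esrc e) by case: (SP (erng e)) => _ SE _ /SE[].
have T_rng e : T_edge e -> H (erng e).
  move=> /T_src Hsrc Y YP; have [YH _] := YP.
  by apply: (YH (esrc e)); [exact: Hsrc | exists [:: e]].
pose T := Subgraph T_src T_rng.
exists T, (fun v => d (val v)); split.
- by move=> e; have [_ SE _] := SP (erng (val e)); have [] := SE _ (set_valP e).
- move=> v _ e1 e2 [/= S1 r1] [/= S2 r2].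
  have [S_sub1 _ _] := SP v.
  by apply: S_sub1; [rewrite -r1 | rewrite -r2].
- apply/seteqP; split=> v.
    move=> [/= Hv no_in]; apply: contrapT => nXv.
    have [_ SE S0] := SP v; have [e Se] := S0 Hv nXv.
    have [ev _ _ _] := SE e Se.
    suff : sedge_into T v e by rewrite no_in.
    by split=> //=; rewrite /T_edge /= ev.
  move=> Xv; split; first exact: XH.
  apply/seteqP; split=> // e [/= Se ev].
  by have [_ SE _] := SP (erng e); have [_ _ []] := SE e Se; rewrite ev.
- by [].
Qed.

End BreadthFirst.

Lemma subgraph_row_finite (F : digraph) (T : subgraph F) :
  row_finite F -> row_finite T.
Proof.
move=> Ffin v.
apply: (@sub_finite_set _ _
  ((val : edge T -> edge F) @^-1` [set e | esrc e = val v])).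
  by move=> e /= <-.
by apply: finite_preimage; [move=> x y _ _; exact: val_inj | exact: Ffin].
Qed.

(** * Skew products *)

Section Skew.
Variables (E : digraph) (G : groupType) (c : edge E -> G).

(** An edge that leaves a vertex of the skew product is determined by its
    projection to [E], because [c e * g] determines [g]. *)
Lemma skew_product_row_finite : row_finite E -> row_finite (skew_product c).
Proof.
move=> Efin [v g].
apply: (@sub_finite_set _ _
  ((fun e => (e, ((c e)^-1 * g)%g)) @` [set e | esrc e = v])).
  by move=> [e h] /= [ev <-]; exists e; rewrite //= mulgA mulVg mul1g.
by apply: finite_image; exact: Efin.
Qed.

Lemma skew_product_label (mu : nat -> edge (skew_product c)) i :
  right_infinite_path mu ->
  (esrc (mu 0)).2 =
  (label_path c (mkseq (fun j => (mu j).1) i) * (esrc (mu i)).2)%g.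
Proof.
move=> muP; elim: i => [|i ->]; first by rewrite /label_path big_nil mul1g.
rewrite /label_path /mkseq -addn1 iotaD map_cat big_cat /= big_seq1 -mulgA.
congr (_ * _)%g; rewrite add0n addn1.
exact: (congr1 (fun v => (c (mu i).1 * v.2)%g) (muP i)).
Qed.

End Skew.

(* The edges mu_1, mu_2, ... of an infinite path are indexed from 0 here, so
   that mkseq mu i is mu_1 ... mu_i. *)
Theorem proposition4p11 (E : digraph) (G : groupType) (c : edge E -> G) :
  row_finite E ->
  (forall mu : nat -> edge E, right_infinite_path mu ->
     exists i : nat, (1 <= i)%N /\ label_path c (mkseq mu i) = 1%g) ->
  exists T : subgraph (skew_product c),
    [/\ directed_subtree T, row_finite T, path_finite T,
        subtree_roots T = [set: vertex E] `*` [set 1%g]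
      & svertex T =
        @hereditary_closure (skew_product c) ([set: vertex E] `*` [set 1%g])].
Proof.
move=> Efin label1.
have [T [d [d_lt T_in T_roots T_vert]]] :=
  @breadth_first_subtree (skew_product c) ([set: vertex E] `*` [set 1%g]).
exists T; split=> //.
- by split=> //; exact: ranked_acyclic d_lt.
- by apply: subgraph_row_finite; exact: skew_product_row_finite.
split; last 2 first.
- by move=> [mu [/(ranked_no_left_infinite d_lt)]].
- by move=> [mu [/(ranked_no_bi_infinite d_lt)]].
move=> [mu [muP _]].
have root_or_in (v : vertex T) :
    subtree_roots T (val v) \/ exists e : edge T, erng e = v.
  have [[e [Te ev]]|no_in] := pselect (sedge_into T (val v) !=set0).
    by right; exists (SigSub (mem_set Te)); apply: val_inj.
  left; split; first exact: set_valP.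
  by apply/seteqP; split=> // e eP; case: no_in; exists e.
have [nu [nuP nu0]] :=
  right_infinite_path_from_root (R := fun v => subtree_roots T (val v))
    d_lt root_or_in muP.
pose nu' i : edge (skew_product c) := val (nu i).
have nu'P : right_infinite_path nu'.
  by move=> i; exact: (congr1 (fun v : vertex T => val v) (nuP i)).
have [i [i_gt0 label_i]] : exists i, (1 <= i)%N /\
    label_path c (mkseq (fun j => (nu' j).1) i) = 1%g.
  by apply: label1 => j; exact: (congr1 (fun v => v.1) (nu'P j)).
have root_i : subtree_roots T (esrc (nu' i)).
  have [_ nu01] : ([set: vertex E] `*` [set 1%g]) (esrc (nu' 0)).
    by rewrite -T_roots.
  rewrite T_roots; split=> //; rewrite /= -[RHS]nu01.
  by rewrite (skew_product_label i nu'P) label_i mul1g.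
case: i i_gt0 {label_i} root_i => // i _ [_ no_in].
suff : sedge_into T (esrc (nu' i.+1)) (nu' i) by rewrite no_in.
by split; [exact: set_valP | exact: nu'P].
Qed.
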